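(* Let $\delta>0$ and fix $\alpha\in[\delta,1]$. There exist constants $\kappa_1,\kappa_2>0$, depending only on $\delta$ and the system parameters $T_R,\tau_1,\tau_2,r_c,r_d,p^\star$ (and not on $\lambda,n,m$ or the policy), such that the following holds. For every $\lambda>0$, and every system with arrival rate $\lambda$, $n$ vehicles, $m$ chargers and a policy $\pi$ whose long-run service level satisfies $1\ge\bar\alpha^{\pi}_{\mathrm{eff}}\ge\alpha$, there exists $\gamma\in[1/3,1/2]$ such that $$n\ \ge\ (1+r)T_R\,\alpha\lambda+\kappa_1\lambda^{1-\gamma}\qquad\text{and}\qquad m\ \ge\ rT_R\,\alpha\lambda+\kappa_2\lambda^{2\gamma}.$$ That is, $n\ge(1+r)T_R\alpha\lambda+\Omega(\lambda^{1-\gamma})$ and $m\ge rT_R\alpha\lambda+\Omega(\lambda^{2\gamma})$.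
   Context: Model (deterministic EV ride-hailing system). Parameters: customer arrival rate $\lambda>0$; number of vehicles $n\ge1$ and number of chargers $m\ge1$ (integers); battery pack size $p^\star>0$ (kWh); discharge rate $r_d>0$ while driving and charge rate $r_c>r_d$ (kW); $r=r_d/r_c\in(0,1)$; average trip time $T_R>0$; constants $\tau_1,\tau_2>0$. A policy $\pi$ (dispatching, admission of customers, routing to chargers, charging sessions) induces the following functions of time $t\ge0$. Nonnegative numbers of vehicles picking up $c_P(t)$, driving with a customer $c_R(t)$, driving to a charger $c_{DC}(t)$, idling $c_I(t)$, charging $c_C(t)$, with $n=c_P(t)+c_R(t)+c_{DC}(t)+c_I(t)+c_C(t)$ and $c_C(t)\le m$; number of customers in the system $q(t)=c_P(t)+c_R(t)$; effective arrival rate $\lambda^\pi_{\mathrm{eff}}(t)\in[0,\lambda]$; average pickup time $T^\pi_P(t)$ and average drive-to-charger time $T^\pi_{DC}(t)$, assumed to satisfy $$T_P^\pi(t)\ge\frac{\tau_1}{\sqrt{n-q(t)}},\qquad T_{DC}^\pi(t)\ge\frac{\tau_2}{\sqrt{m-c_C(t)}}\qquad\text{for all }t;$$ the fraction $p^\pi_{dc}(t)\in[0,1]$ of EVs driving to a charger that eventually reach one; the average charging time $T^\pi_C(t)\in(0,p^\star/r_c]$; and the aggregate state of charge $s(t)$ of the fleet (in kWh, $0\le s(t)\le np^\star$). Under any policy these evolve according to $$\dot q(t)=\lambda^\pi_{\mathrm{eff}}(t)-\frac{q(t)}{T_R+T_P^\pi(t)},\qquad \dot c_C(t)=p^\pi_{dc}(t)\frac{c_{DC}(t)}{T^\pi_{DC}(t)}-\frac{c_C(t)}{T^\pi_C(t)},\qquad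 \dot s(t)=c_C(t)r_c-(n-c_C(t)-c_I(t))r_d,$$ from some initial condition. Convention: $1/\sqrt0=+\infty$ and $x/(+\infty)=0$ for finite $x$. The long-run service level is $\bar\alpha^\pi_{\mathrm{eff}}=\frac1\lambda\limsup_{T\to\infty}\frac1T\int_0^T\lambda^\pi_{\mathrm{eff}}(t)\,dt$. *)

(* Defs.v *)
From HB Require Import structures.
From mathcomp Require Import all_boot all_order all_algebra.
From mathcomp Require Import all_classical all_reals all_analysis.

Set Implicit Arguments.
Unset Strict Implicit.
Unset Printing Implicit Defensive.

Import Order.TTheory GRing.Theory Num.Theory.
Import numFieldNormedType.Exports.

Local Open Scope classical_set_scope.
Local Open Scope ring_scope.

(** The constants that depend neither on the demand, nor on the numbers of
    vehicles and chargers, nor on the policy. *)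
Record ev_params (R : realType) := EVParams {
  trip_time : R;        (* T_R *)
  pickup_const : R;     (* tau_1 *)
  charger_const : R;    (* tau_2 *)
  charge_rate : R;      (* r_c, in kW *)
  discharge_rate : R;   (* r_d, in kW *)
  pack_size : R;        (* p^star, in kWh *)
  trip_time_gt0 : 0 < trip_time;
  pickup_const_gt0 : 0 < pickup_const;
  charger_const_gt0 : 0 < charger_const;
  discharge_rate_gt0 : 0 < discharge_rate;
  discharge_lt_charge : discharge_rate < charge_rate;
  pack_size_gt0 : 0 < pack_size
}.

Definition rate_ratio (R : realType) (P : ev_params R) : R :=
  discharge_rate P / charge_rate P.

(** The functions of time induced by a policy; only their values at times
    [t >= 0] matter.  The pickup and drive-to-charger times are extended reals:
    they are forced to be infinite when no vehicle (resp. charger) is free. *)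
Record ev_traj (R : realType) := EVTraj {
  cP : R -> R;            (* picking up a customer *)
  cR : R -> R;            (* driving with a customer *)
  cDC : R -> R;           (* driving to a charger *)
  cI : R -> R;            (* idling *)
  cC : R -> R;            (* charging *)
  eff_rate : R -> R;      (* effective arrival rate *)
  pickup_time : R -> \bar R;
  to_charger_time : R -> \bar R;
  reach_frac : R -> R;    (* p_dc *)
  charging_time : R -> R;
  soc : R -> R            (* aggregate state of charge s, in kWh *)
}.

Definition customers (R : realType) (x : ev_traj R) (t : R) : R :=
  cP x t + cR x t.

(** Absolute continuity on [[a, b]]; [s] lists finitely many non-overlapping
    subintervals [[p.1, p.2]], from left to right. *)
Definition abs_continuous_on (R : realType) (a b : R) (f : R -> R) : Prop :=
  forall e : R, 0 < e -> exists2 d : R, 0 < d &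
    forall s : seq (R * R),
      (forall p, p \in s -> (a <= p.1) && (p.1 <= p.2) && (p.2 <= b)) ->
      pairwise (fun p p' : R * R => p.2 <= p'.1) s ->
      \sum_(p <- s) (p.2 - p.1) < d ->
      \sum_(p <- s) `|f p.2 - f p.1| < e.

(** [f] solves [f' = g] on [[0, +oo[[ in the sense of Caratheodory: the controls
    may be discontinuous in time, so the derivative is prescribed at almost
    every time, and [f] is locally absolutely continuous.  The right-hand side
    is an extended real because of the conventions on infinite travel times. *)
Definition evolves (R : realType) (f : R -> R) (g : R -> \bar R) : Prop :=
  (forall T : R, 0 <= T -> abs_continuous_on 0 T f) /\
  {ae lebesgue_measure, forall t : R,
    0 < t -> derivable f t 1 /\ (derive1 f t)%:E = g t}.

(** Travel times are handled with division in [\bar R], for which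
    [0^-1 = +oo] and [+oo^-1 = 0]; hence [tau / 0 = +oo] for [tau > 0] and
    [x / +oo = 0] for every real [x]. *)
Record ev_system (R : realType) (P : ev_params R) (lambda : R) (n m : nat)
    (x : ev_traj R) : Prop := EVSystem {
  fleet_ge0 : forall t : R, 0 <= t ->
    [/\ 0 <= cP x t, 0 <= cR x t, 0 <= cDC x t, 0 <= cI x t & 0 <= cC x t];
  fleet_sum : forall t : R, 0 <= t ->
    n%:R = cP x t + cR x t + cDC x t + cI x t + cC x t;
  chargers_le : forall t : R, 0 <= t -> cC x t <= m%:R;
  eff_rate_measurable : measurable_fun (`[0, +oo[%classic : set R) (eff_rate x);
  eff_rate_bounds : forall t : R, 0 <= t -> 0 <= eff_rate x t <= lambda;
  pickup_time_ge : forall t : R, 0 <= t ->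
    ((pickup_const P)%:E / (Num.sqrt (n%:R - customers x t))%:E
       <= pickup_time x t)%E;
  to_charger_time_ge : forall t : R, 0 <= t ->
    ((charger_const P)%:E / (Num.sqrt (m%:R - cC x t))%:E
       <= to_charger_time x t)%E;
  reach_frac_bounds : forall t : R, 0 <= t -> 0 <= reach_frac x t <= 1;
  charging_time_bounds : forall t : R, 0 <= t ->
    0 < charging_time x t <= pack_size P / charge_rate P;
  soc_bounds : forall t : R, 0 <= t -> 0 <= soc x t <= n%:R * pack_size P;
  customers_evol : evolves (customers x) (fun t =>
    ((eff_rate x t)%:E
       - (customers x t)%:E / ((trip_time P)%:E + pickup_time x t))%E);
  charging_evol : evolves (cC x) (fun t =>
    ((reach_frac x t)%:E * ((cDC x t)%:E / to_charger_time x t)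
       - (cC x t / charging_time x t)%:E)%E);
  soc_evol : evolves (soc x) (fun t =>
    (cC x t * charge_rate P
       - (n%:R - cC x t - cI x t) * discharge_rate P)%:E)
}.

Definition service_level (R : realType) (lambda : R) (x : ev_traj R) : \bar R :=
  ((lambda^-1)%:E *
   limf_esup (fun T : R =>
       (T^-1)%:E * \int[lebesgue_measure]_(t in `[0%R, T]) (eff_rate x t)%:E)
     (pinfty_nbhs R))%E.

(* Main.v *)
Require Import Defs.
From HB Require Import structures.
From mathcomp Require Import all_boot all_order all_algebra.
From mathcomp Require Import all_classical all_reals all_analysis.
From mathcomp Require Import measurable_realfun ring lra.

Import Order.TTheory GRing.Theory Num.Theory.
Import numFieldNormedType.Exports.

Local Open Scope ring_scope.

(** Time averages satisfy linear relations: the fleet splits into its five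
    states, the state of charge is bounded so that on average the number of
    charging vehicles is [r] times the number of driving ones, and Little's law
    bounds the number of customers below by
    [theta * alpha * lambda], where [theta = T_R + tau_1 / sqrt n] is the least
    time that a customer spends in the system.  What remains is the cost [D] of
    the drives to the chargers, against the average number [E] of free
    chargers.  In a steady state the flow into the chargers,
    [D * sqrt E / tau_2], makes up for the vehicles that leave, at rate at least
    [K * cC] with [K = r_c / p^star]; hence [D * sqrt E] is at least of order
    [lambda].

    The difficulty is that the product of [cDC] and [sqrt (m - cC)] is not
    concave, so that a fluctuating policy might beat this steady state.  It
    cannot: the derivative of [W = sqrt (m - cC + eta)] is at least
    [K * cC / (2 * W) - cDC / (2 * tau_2)], in which [cDC] stands alone, and
    [cC / W] is convex in [cC].  Averaging this inequality gives
    [D >= tau_2 * K * avg (cC / W)], and Jensen's inequality gives the steady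
    bound.

    No average of the state is actually taken, since [cDC] and [cI] need not even
    be measurable.  Convexity is used through one supporting line
    ([inv_sqrt_tangent]), and the balances are added into one function of time
    [G], a linear combination of the customers, the state of charge and [W],
    such that [c * eff_rate + G' <= k] almost everywhere for constants [c] and
    [k].  As [G] is bounded, [c * alpha * lambda <= k] follows
    ([service_level_le]); this is the requirement [fleet_requirement], which is
    used once for the vehicles and once for the chargers.  The step from a
    derivative almost everywhere to increments is [abs_continuous_le].

    Write [X] and [Y] for the excesses of [n] and [m] over their leading terms.
    The average number of free chargers is at most [m - r * theta * alpha * lambda],
    and placing the supporting line there leads to
    [X >= const * lambda / sqrt Y] and [Y >= const * lambda / sqrt Y], while the
    term [tau_1 / sqrt n] of [theta] leads to [X >= const * sqrt lambda].
    These three facts produce [gamma] ([exponent_choice]): the first one is the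
    trade-off for [gamma] with [lambda `^ (2 * gamma) = Y], the second one keeps
    [gamma] from dropping below [1/3], and the last one bounds the vehicles when
    [gamma] would exceed [1/2]. *)

(** * Absolutely continuous functions with a nonpositive derivative *)

(** Cousin's theorem in inductive form: the supremum of the points of [[0, T]]
    where [Q] holds is reached from its left and passed on its right, because
    the step at [t] may start before [t] and end after it. *)
Lemma gauge_induction (R : realType) (T : R) (Q : R -> Prop) :
  0 <= T -> Q 0 ->
  (forall t, 0 <= t <= T -> exists2 h, 0 < h &
     forall u v, 0 <= u -> u <= t -> t <= v -> v <= T ->
       t - h < u -> v < t + h -> Q u -> Q v) ->
  Q T.
Proof.
move=> T0 Q0 step.
pose S := [set x : R | 0 <= x <= T /\ Q x]%classic.
have S0 : S 0 by split; rewrite ?lexx.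
have supS : has_sup S.
  by split; [exists 0 | exists T => x [/andP[]]].
have ubS x : S x -> x <= sup S by move=> Sx; apply: sup_upper_bound.
have tT : 0 <= sup S <= T.
  rewrite ubS//=; apply: ge_sup; first by exists 0.
  by move=> x [/andP[]].
have [h h0 hstep] := step _ tT.
have [u [/andP[u0 uT] Qu] hu] := sup_adherent h0 supS.
have [t0 tT'] := andP tT.
pose v := Num.min T (sup S + h / 2).
have tv : sup S <= v by rewrite le_min tT' /=; lra.
have Qv : Q v.
  apply: (hstep u) => //.
  - by apply: ubS; split; rewrite ?u0.
  - by rewrite ge_min lexx.
  - by rewrite gt_min; apply/orP; right; lra.
have vS : v <= sup S by apply: ubS; split => //; rewrite ge_min lexx/= (le_trans t0).
move: vS Qv; rewrite /v; case: (leP T (sup S + h / 2)) => // _ ? _; exfalso; lra.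
Qed.

Lemma sum_lengths_le_measure (R : realType) (U : set R) (s : seq (R * R)) :
  measurable U ->
  (forall p, p \in s -> p.1 <= p.2 /\ (`[p.1, p.2] `<=` U)%classic) ->
  pairwise (fun p p' : R * R => p.2 <= p'.1) s ->
  ((\sum_(p <- s) (p.2 - p.1))%:E <= lebesgue_measure U)%E.
Proof.
move=> mU sU sP.
pose B (s : seq (R * R)) := \big[setU/set0]_(p <- s) (`]p.1, p.2]%classic : set R).
have mB s' : measurable (B s').
  by apply: bigsetU_measurable => p _; exact: measurable_itv.
have BE : ((\sum_(p <- s) (p.2 - p.1))%:E = lebesgue_measure (B s))%E.
  elim: s sU sP => [_ _|p s IH sU /= /andP[ps sP]].
    by rewrite /B !big_nil measure0.
  rewrite /B !big_cons measureU.
  - rewrite EFinD IH//; last by move=> q qs; apply: sU; rewrite in_cons qs orbT.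
    congr (_ + _)%E; apply/esym; apply: (etrans (lebesgue_measure_itv `]p.1, p.2])).
    rewrite /= lte_fin.
    have [p12 _] := sU p (mem_head _ _).
    by case: ltgtP p12 => // -> _; rewrite subrr.
  - exact: measurable_itv.
  - exact: mB.
  - apply/seteqP; split => // x [/=]; rewrite in_itv/= => /andP[_ xp].
    rewrite -bigcup_seq => -[q /= qs]; rewrite in_itv/= => /andP[qx _].
    by have := lt_le_trans qx xp; rewrite ltNge (allP ps q qs).
have BU : (B s `<=` U)%classic.
  rewrite /B -bigcup_seq => x [p /= ps]; rewrite in_itv/= => /andP[px xp].
  by apply: (sU p ps).2; rewrite /= in_itv/= xp ltW.
by rewrite BE; apply: le_measure => //; rewrite inE; [exact: mB|exact: mU].
Qed.

(** Increments over intervals around [t], and not only from [t], are controlled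
    by the derivative at [t]: the errors on both sides of [t] add up to
    [e * (v - u)]. *)
Lemma straddle (R : realType) (f : R -> R) (t k e : R) :
  derivable f t 1 -> derive1 f t <= k -> 0 < e ->
  exists2 h, 0 < h & forall u v, u <= t -> t <= v -> t - h < u -> v < t + h ->
    f v - f u <= (k + e) * (v - u).
Proof.
move=> df fk e0.
have : (h^-1 *: (f (h + t) - f t) @[h --> 0^'] --> derive1 f t)%classic.
  move: df; rewrite /derivable derive1E /derive => df.
  have -> : (fun h : R => h^-1 *: (f (h + t) - f t)) =
            (fun h : R => h^-1 *: ((f \o shift t) (h *: 1) - f t)).
    by apply/funext => h /=; rewrite /shift /= [_ *: 1]mulr1.
  exact: df.
move/cvgrPdist_le => /(_ _ e0) => -[h /= h0 hP].
have lip y : `|y - t| < h -> `|f y - f t - derive1 f t * (y - t)| <= e * `|y - t|.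
  have [->|yt] := eqVneq y t; first by rewrite !subrr mulr0 subrr normr0 mulr0.
  move=> yh; have yt0 : y - t != 0 by rewrite subr_eq0.
  have := hP (y - t); rewrite /= sub0r normrN => /(_ yh yt0).
  rewrite subrK => hy.
  have -> : f y - f t - derive1 f t * (y - t) =
      - ((derive1 f t - (y - t)^-1 *: (f y - f t)) * (y - t)).
    rewrite mulrBl -[(y - t)^-1 *: _]/((y - t)^-1 * _).
    by rewrite [_^-1 * _ * _]mulrAC mulVf// mul1r opprB.
  by rewrite normrN normrM ler_wpM2r.
exists h => // u v ut tv hu hv.
have := lip v; rewrite ger0_norm ?subr_ge0// => /(_ ltac:(lra)).
have := lip u; rewrite ler0_norm ?subr_le0// => /(_ ltac:(lra)).
rewrite !ler_norml => /andP[A1 A2] /andP[B1 B2].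
have : derive1 f t * (v - u) <= k * (v - u) by rewrite ler_wpM2r// subr_ge0 (le_trans ut).
nra.
Qed.

(** Gauge induction builds [0 = x_0 <= x_1 <= ... <= T] such that [f] grows over
    each [[x_i, x_(i+1)]] with slope at most [e], or that interval lies in a
    small open set around the exceptional times.  Absolute continuity bounds the
    total variation over intervals of the second kind, whose total length is at
    most the measure of that open set. *)
Lemma abs_continuous_le (R : realType) (f : R -> R) (T : R) :
  0 <= T -> abs_continuous_on 0 T f ->
  {ae lebesgue_measure, forall t : R, 0 < t -> derivable f t 1 /\ derive1 f t <= 0} ->
  f T <= f 0.
Proof.
move=> T0 acf aef.
suff H e : 0 < e -> f T - f 0 <= e * T + e.
  rewrite -subr_le0; apply/ler_addgt0Pr => e e0; rewrite add0r.
  have e1 : 0 < e / (T + 1) by rewrite divr_gt0//; lra.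
  have := H _ e1.
  have : e / (T + 1) * (T + 1) = e by rewrite divfK//; lra.
  lra.
move=> e0; have [d d0 dP] := acf _ e0.
(* 0 is added because the derivative is prescribed at positive times only. *)
pose N := [set t : R | ~ (0 < t -> derivable f t 1 /\ derive1 f t <= 0)]%classic.
have negN : lebesgue_measure.-negligible (N `|` [set 0])%classic.
  apply: negligibleU; first exact: aef.
  exists [set 0]%classic; split => //; exact: lebesgue_measure_set1.
have d2 : 0 < d / 2 by lra.
have [U [oU NU mUd]] := @outer_measure_open_le R (N `|` [set 0])%classic (d / 2) d2.
move/negligible_outer_measure in negN.
rewrite negN add0e in mUd.
(* [s] collects the intervals up to [x] that lie in [U]. *)
pose Q x := exists s : seq (R * R),
  [/\ forall p, p \in s -> [/\ 0 <= p.1, p.1 <= p.2, p.2 <= x & (`[p.1, p.2] `<=` U)%classic],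
      pairwise (fun p p' : R * R => p.2 <= p'.1) s &
      f x - f 0 <= e * x + \sum_(p <- s) `|f p.2 - f p.1|].
have : Q T.
  apply: gauge_induction => //.
    by exists [::]; split => //; rewrite big_nil; lra.
  move=> t /andP[t0 tT].
  have [Ut|nUt] := pselect (U t).
    have [h /= h0 hU] := oU t Ut.
    exists h => // u v u0 ut tv vT hu hv [s [sU sP sf]].
    exists (rcons s (u, v)); split.
    - move=> p; rewrite mem_rcons in_cons => /orP[/eqP ->/=|/sU[p0 p12 pu pU]].
        split => //; first exact: le_trans tv.
        move=> x /=; rewrite in_itv/= => /andP[ux xv].
        by apply: hU; rewrite /= ltr_norml; apply/andP; split; lra.
      by split => //; rewrite (le_trans pu)// (le_trans ut).
    - rewrite pairwise_rcons sP andbT; apply/allP => p /sU[_ _ pu _] //.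
    - rewrite big_rcons/=; have := ler_norm (f v - f u).
      have : 0 <= e * (v - u) by rewrite mulr_ge0; lra.
      lra.
  have tne0 : t != 0 by apply: contra_notN nUt => /eqP ->; apply: NU; right.
  have [] : derivable f t 1 /\ derive1 f t <= 0.
    have : ~ N t by move=> Nt; apply: nUt; apply: NU; left.
    by move/contrapT; apply; rewrite lt_neqAle eq_sym tne0.
  move=> df fk; have [h h0 hP] := straddle _ _ _ _ _ df fk e0.
  exists h => // u v u0 ut tv vT hu hv [s [sU sP sf]].
  exists s; split => //.
    by move=> p /sU[p0 p12 pu pU]; split => //; rewrite (le_trans pu)// (le_trans ut).
  have := hP u v ut tv hu hv; lra.
move=> [s [sU sP sf]].
have : \sum_(p <- s) `|f p.2 - f p.1| < e.
  apply: dP => // [p /sU[-> -> ->//]|].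
  rewrite -lte_fin; apply: le_lt_trans (_ : (d / 2)%:E < d%:E)%E; last by rewrite lte_fin; lra.
  apply: le_trans mUd; apply: sum_lengths_le_measure => //.
    exact: open_measurable.
  by move=> p /sU[].
lra.
Qed.

(** * Closure properties of absolute continuity; running integrals *)

(** Two dominating functions are allowed so that sums, multiples and
    compositions with Lipschitz functions are all instances. *)
Lemma abs_continuous_dominated (R : realType) (a b L : R) (f g F : R -> R) :
  abs_continuous_on a b f -> abs_continuous_on a b g ->
  (forall x y, a <= x -> x <= y -> y <= b ->
     `|F y - F x| <= L * (`|f y - f x| + `|g y - g x|)) ->
  abs_continuous_on a b F.
Proof.
move=> acf acg FL e e0.
have L1 : 0 < 2 * (`|L| + 1) by rewrite mulr_gt0// ltr_wpDl.
have e1 : 0 < e / (2 * (`|L| + 1)) by rewrite divr_gt0.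
have [d1 d10 h1] := acf _ e1; have [d2 d20 h2] := acg _ e1.
exists (Num.min d1 d2); first by rewrite lt_min d10.
move=> s sab sP; rewrite lt_min => /andP[sd1 sd2].
have f1 := h1 s sab sP sd1; have g1 := h2 s sab sP sd2.
apply: (@le_lt_trans _ _ (\sum_(p <- s) (`|L| + 1) * (`|f p.2 - f p.1| + `|g p.2 - g p.1|))).
  rewrite big_seq [leRHS]big_seq; apply: ler_sum => p /sab /andP[/andP[ap pp] pb].
  apply: le_trans (FL _ _ ap pp pb) _; rewrite ler_wpM2r ?addr_ge0//.
  by rewrite (le_trans (ler_norm _))// lerDl.
rewrite -mulr_sumr big_split/=.
have -> : e = (`|L| + 1) * (e / (2 * (`|L| + 1)) + e / (2 * (`|L| + 1))).
  by field; rewrite gt_eqF// ltr_wpDl.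
by rewrite ltr_pM2l ?ltrD// ltr_wpDl.
Qed.

Lemma lipschitz_abs_continuous (R : realType) (a b L : R) (F : R -> R) :
  (forall x y, a <= x -> x <= y -> y <= b -> `|F y - F x| <= L * (y - x)) ->
  abs_continuous_on a b F.
Proof.
move=> FL e e0.
have L1 : 0 < `|L| + 1 by rewrite ltr_wpDl.
exists (e / (`|L| + 1)); first by rewrite divr_gt0.
move=> s sab _ sd.
apply: (@le_lt_trans _ _ (\sum_(p <- s) (`|L| + 1) * (p.2 - p.1))).
  rewrite big_seq [leRHS]big_seq; apply: ler_sum => p /sab /andP[/andP[ap pp] pb].
  apply: le_trans (FL _ _ ap pp pb) _; rewrite ler_wpM2r ?subr_ge0//.
  by rewrite (le_trans (ler_norm _))// lerDl.
by rewrite -mulr_sumr mulrC -ltr_pdivlMr.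
Qed.

Lemma abs_continuousD (R : realType) (a b : R) (f g : R -> R) :
  abs_continuous_on a b f -> abs_continuous_on a b g ->
  abs_continuous_on a b (fun t => f t + g t).
Proof.
move=> acf acg; apply: (abs_continuous_dominated _ _ _ 1 _ _ _ acf acg) => x y _ _ _.
by rewrite mul1r opprD addrACA ler_normD.
Qed.

Lemma abs_continuousZ (R : realType) (a b c : R) (f : R -> R) :
  abs_continuous_on a b f -> abs_continuous_on a b (fun t => c * f t).
Proof.
move=> acf; apply: (abs_continuous_dominated _ _ _ `|c| _ _ _ acf acf) => x y _ _ _.
by rewrite -mulrBr normrM ler_wpM2l// lerDl.
Qed.

Section running_integral.
Variables (R : realType) (l : R -> R) (M : R).
Hypothesis ml : measurable_fun (`[0, +oo[%classic : set R) l.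
Hypothesis lM : forall t, 0 <= t -> 0 <= l t <= M.

Local Notation mu := (@lebesgue_measure R).

Definition running_integral (x : R) : R := (\int[mu]_(t in `[0, x]) l t)%R.

Let bounded_on (A : set R) : (A `<=` `[0, +oo[)%classic ->
  measurable A -> (mu A < +oo)%E ->
  mu.-integrable A (EFin \o l).
Proof.
move=> A0 mA Afin; apply: measurable_bounded_integrable => //.
  by apply: measurable_funS ml.
exists M; split; rewrite ?num_real// => x Mx t /A0 /=.
rewrite in_itv/= andbT => t0; have /andP[l0 lt] := lM t t0.
by rewrite ger0_norm// (le_trans lt)// ltW.
Qed.

Let itv_fin (a b : R) (A := (`[a, b]%classic : set R)) : (mu A < +oo)%E.
Proof. by rewrite /A lebesgue_measure_itv/=; case: ifP => _; rewrite ?ltry// -EFinB ltry. Qed.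

Let itv_int (x : R) :
  mu.-integrable (`[0, x]%classic : set R) (EFin \o l).
Proof.
apply: bounded_on; [|exact: measurable_itv|exact: itv_fin].
by move=> t /=; rewrite !in_itv/= => /andP[->].
Qed.

Lemma running_integralE (x : R) :
  (\int[mu]_(t in `[0%R, x]) (l t)%:E)%E = (running_integral x)%:E.
Proof.
rewrite /running_integral /Rintegral fineK//; apply: integrable_fin_num.
  exact: measurable_itv.
exact: itv_int.
Qed.

Lemma running_integral0 : running_integral 0 = 0.
Proof. by rewrite /running_integral set_itv1 Rintegral_set1. Qed.

Lemma running_integral_lipschitz (x y : R) : 0 <= x -> x <= y ->
  `|running_integral y - running_integral x| <= M * (y - x).
Proof.
move=> x0 xy.
rewrite /running_integral Rintegral_itvB; [|exact: itv_int|by rewrite bnd_simp|by rewrite bnd_simp].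
have sub0 : (`]x, y] `<=` `[0, +oo[)%classic.
  by move=> t /=; rewrite !in_itv/= andbT => /andP[/ltW xt _]; exact: le_trans xt.
have intl : mu.-integrable (`]x, y]%classic : set R) (EFin \o l).
  apply: integrableS (itv_int y) => //.
  by move=> t /=; rewrite !in_itv/= => /andP[/ltW xt ->]; rewrite (le_trans x0).
rewrite ger0_norm; last first.
  by apply: Rintegral_ge0 => t /sub0/=; rewrite in_itv/= andbT => /lM/andP[].
have -> : M * (y - x) = (\int[mu]_(t in `]x, y]) (cst M t))%R.
  rewrite Rintegral_cst//; congr (M * _); apply/esym.
  apply: etrans (congr1 fine (lebesgue_measure_itv `]x, y])) _.
  by rewrite /= lte_fin; case: ltgtP xy => //= -> _; rewrite subrr.
apply: le_Rintegral => //.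
  apply: measurable_bounded_integrable => //; last exact: bounded_cst.
  apply: le_lt_trans (itv_fin x y); apply: le_measure; rewrite ?inE//.
  exact: subset_itv_oc_cc.
by move=> t /sub0/=; rewrite in_itv/= andbT => /lM/andP[].
Qed.

(** [l] is only measurable on nonnegative times, so Lebesgue's theorem is applied
    to its extension by zero. *)
Lemma derive_running_integral :
  {ae lebesgue_measure, forall t : R, 0 < t ->
     derivable running_integral t 1 /\ derive1 running_integral t = l t}.
Proof.
pose l0 := (l \_ `[0, +oo[)%classic.
have ll0 t : 0 <= t -> l0 t = l t.
  by move=> t0; rewrite /l0 patchE mem_set//= in_itv/= t0.
have E x : running_integral x = (\int[mu]_(t in `[0, x]) l0 t)%R.
  by apply: eq_Rintegral => t; rewrite inE/= in_itv/= => /andP[t0 _]; rewrite ll0.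
have ml0 : measurable_fun setT l0 by exact/(measurable_restrictT _ _).1.
have l0M t : `|l0 t| <= M.
  have [t0|t0] := leP 0 t; first by rewrite ll0// ger0_norm; have /andP[] := lM _ t0.
  rewrite /l0 patchE memNset ?normr0; last by rewrite /= in_itv/= andbT leNgt t0.
  by have /andP[/le_trans] := lM 0 (lexx _); apply.
have intl0 (K : set R) : measurable K -> (mu K < +oo)%E ->
  mu.-integrable K (EFin \o l0).
  move=> mK Kfin; apply: measurable_bounded_integrable => //.
    exact: measurable_funS ml0.
  by exists M; split; rewrite ?num_real// => x Mx t _ /=; rewrite (le_trans (l0M t))// ltW.
have locl0 : locally_integrable setT l0.
  split => //; first exact: openT.
  move=> K _ cK.
  have /integrableP[_] := intl0 K (compact_measurable cK) (compact_finite_measure cK).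
  exact.
have intl0y y : mu.-integrable [set` Interval (BLeft 0) (BRight y)] (EFin \o l0).
  by apply: intl0; [exact: measurable_itv|exact: itv_fin].
have := FTC1 intl0y locl0.
apply: filterS; first exact: (ae_filter_ringOfSetsType mu).
move=> t /= + t0 => /(_ t0).
have -> : (fun x => (\int[mu]_(t1 in `[0, x]) l0 t1)%R) = running_integral.
  by apply/funext => y; rewrite E.
by rewrite ll0// ltW.
Qed.

End running_integral.

(** * Bounds on the long-run service level *)

Lemma limsup_frequently (R : realType) (a : R) (g : R -> \bar R) :
  (a%:E <= limf_esup g (pinfty_nbhs R))%E ->
  forall e M : R, 0 < e -> exists2 T, M < T & ((a - e)%:E < g T)%E.
Proof.
move=> ag e M e0.
have : ((a - e)%:E < ereal_sup (g @` [set T : R | (M < T)%R]%classic))%E.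
  apply: (@lt_le_trans _ _ a%:E); first by rewrite lte_fin gtrBl.
  apply: le_trans ag _; rewrite limf_esupE; apply: ereal_inf_lbound.
  by exists [set T : R | M < T]%classic => //; exists M; split; rewrite ?num_real.
by move/ereal_sup_gt => [_ [T /= MT <-] aT]; exists T.
Qed.

(** The function [c * A + G - k * t], where [A] is the running integral of the
    effective arrival rate, is nonincreasing.  Hence [c * A T <= k * T + 2 * B],
    which is compared with the limit superior of [A T / T]. *)
Lemma service_level_le (R : realType) (lambda alpha c k B : R) (x : ev_traj R) (G : R -> R) :
  0 < lambda -> 0 <= c ->
  measurable_fun (`[0, +oo[%classic : set R) (eff_rate x) ->
  (forall t : R, 0 <= t -> 0 <= eff_rate x t <= lambda) ->
  (forall T : R, 0 <= T -> abs_continuous_on 0 T G) ->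
  (forall T : R, 0 <= T -> `|G T| <= B) ->
  {ae lebesgue_measure, forall t : R,
     0 < t -> derivable G t 1 /\ c * eff_rate x t + derive1 G t <= k} ->
  (alpha%:E <= service_level lambda x)%E ->
  c * (alpha * lambda) <= k.
Proof.
move=> lambda0 c0 ml lM acG GB dG sl.
have sl' : ((alpha * lambda)%:E <= limf_esup (fun T : R =>
   (T^-1)%:E * (running_integral _ (eff_rate x) T)%:E)%E (pinfty_nbhs R))%E.
  have : (lambda%:E * alpha%:E <= lambda%:E * service_level lambda x)%E.
    by rewrite lee_pmul2l ?lte_fin.
  rewrite -EFinM mulrC /service_level muleA -EFinM divff ?gt_eqF// mul1e.
  congr (_ <= limf_esup _ _)%E; apply/funext => T; congr (_ * _)%E.
  exact: (running_integralE _ _ lambda).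
have key T : 0 <= T -> c * running_integral _ (eff_rate x) T <= k * T + 2 * B.
  move=> T0.
  pose F t := c * running_integral _ (eff_rate x) t + G t + (- k) * t.
  have : F T <= F 0.
    apply: abs_continuous_le => //.
      apply: abs_continuousD; first apply: abs_continuousD.
      - apply/abs_continuousZ/(lipschitz_abs_continuous _ _ _ lambda) => u v u0 uv _.
        exact: running_integral_lipschitz.
      - exact: acG.
      - apply/abs_continuousZ/(lipschitz_abs_continuous _ _ _ 1) => u v u0 uv _.
        by rewrite mul1r ger0_norm// subr_ge0.
    have := derive_running_integral _ (eff_rate x) lambda ml lM.
    apply: filterS2 dG; first exact: (ae_filter_ringOfSetsType lebesgue_measure).
    move=> t /[swap] H1 /[swap] t0 /(_ t0)[dGt Gk]; have [dA At] := H1 t0.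
    move: At Gk; rewrite !derive1E => At Gk.
    have dF : is_derive t 1 F (c * eff_rate x t + 'D_1 G t + (- k) * 1).
      have dA' : is_derive t 1 (running_integral _ (eff_rate x)) (eff_rate x t).
        by split; rewrite // -At.
      have dG' : is_derive t 1 G ('D_1 G t) by split.
      by rewrite /F; apply: is_deriveD.
    split; first exact: ex_derive.
    by rewrite derive_val mulr1; lra.
  rewrite /F running_integral0 !mulr0 addr0 add0r => H.
  have := GB T T0; have := GB 0 (lexx 0); rewrite !ler_norml => /andP[? ?] /andP[? ?].
  lra.
apply/ler_addgt0Pr => e e0.
have e1 : 0 < e / (2 * (c + 1)) by rewrite divr_gt0//; lra.
(* The threshold on [T] makes the boundary term [2 * B] at most [e / 2 * T]. *)
have [T MT] := limsup_frequently _ _ _ sl' (e / (2 * (c + 1))) (`|4 * B / e|) e1.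
have T0 : 0 < T by apply: le_lt_trans MT.
rewrite -EFinM lte_fin [_^-1 * _]mulrC ltr_pdivlMr// => AT.
have := key T (ltW T0).
have BT : 2 * B <= e / 2 * T.
  have : 4 * B / e < T by apply: le_lt_trans MT; exact: ler_norm.
  by rewrite ltr_pdivrMr// => ?; lra.
have cA : c * ((alpha * lambda - e / (2 * (c + 1))) * T) <= c * running_integral _ (eff_rate x) T.
  by rewrite ler_wpM2l// ltW.
move=> kT.
have ce : c * (e / (2 * (c + 1))) <= e / 2.
  have -> : c * (e / (2 * (c + 1))) = e / 2 * (c / (c + 1)) by field; lra.
  by rewrite ler_piMr; rewrite ?ler_pdivrMr//; lra.
rewrite -(ler_pM2r T0).
have : c * (e / (2 * (c + 1))) * T <= e / 2 * T by rewrite ler_wpM2r// ltW.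
lra.
Qed.

(** * Pointwise consequences of the dynamics *)

Lemma lee_div_fin (R : realType) (z b : R) (y : \bar R) :
  0 <= z -> 0 < b -> (b%:E <= y)%E -> (z%:E / y <= (z / b)%:E)%E.
Proof.
move=> z0 b0; case: y => [y|_|]//.
- rewrite lee_fin => by_; have y0 : 0 < y by apply: lt_le_trans by_.
  by rewrite inver gt_eqF// -EFinM lee_fin ler_wpM2l// lef_pV2.
- by rewrite invey mule0 lee_fin divr_ge0// ltW.
Qed.

Lemma div_ge0_fin (R : realType) (z b : R) (y : \bar R) :
  0 <= z -> 0 < b -> (b%:E <= y)%E -> (0 <= z%:E / y)%E.
Proof.
move=> z0 b0 yb; rewrite mule_ge0 ?lee_fin// inve_ge0.
by apply: le_trans yb; rewrite lee_fin ltW.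
Qed.

(** At [z = 0] the right-hand side is infinite: this is the convention
    [1 / sqrt 0 = +oo]. *)
Lemma le_div_sqrt (R : realType) (tau z N : R) : 0 < tau -> 0 < N -> 0 <= z <= N ->
  ((tau / Num.sqrt N)%:E <= tau%:E / (Num.sqrt z)%:E)%E.
Proof.
move=> tau0 N0 /andP[z0 zN].
have [<-|zn0] := eqVneq 0 z.
  by rewrite sqrtr0 inver eqxx gt0_muley ?lte_fin// leey.
have zpos : 0 < z by rewrite lt_neqAle zn0.
rewrite inver gt_eqF ?sqrtr_gt0// -EFinM lee_fin ler_wpM2l ?(ltW tau0)//.
by rewrite lef_pV2 ?posrE ?sqrtr_gt0// ler_wsqrtr.
Qed.

(** A charging session lasts at most the time of a full charge, so chargers are
    vacated at least at this rate. *)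
Definition unplug_rate {R : realType} (P : ev_params R) : R :=
  charge_rate P / pack_size P.

(** The least time that a customer spends in a system of [n] vehicles, since a
    pickup takes at least [tau_1 / sqrt n]. *)
Definition trip_pickup_time {R : realType} (P : ev_params R) (n : nat) : R :=
  trip_time P + pickup_const P / Num.sqrt n%:R.

Section dynamics.
Variables (R : realType) (P : ev_params R) (lambda : R) (n m : nat) (x : ev_traj R).
Hypotheses (n0 : (1 <= n)%N) (sys : ev_system P lambda n m x).

Local Notation q := (customers x).
Local Notation theta := (trip_pickup_time P n).
Local Notation K := (unplug_rate P).
Local Notation r := (rate_ratio P).

Lemma charge_rate_gt0 : 0 < charge_rate P.
Proof. exact: lt_trans (discharge_rate_gt0 P) (discharge_lt_charge P). Qed.

Lemma rate_ratio_gt0 : 0 < r.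
Proof. by rewrite divr_gt0 ?discharge_rate_gt0 ?charge_rate_gt0. Qed.

Lemma trip_pickup_time_ge : trip_time P <= theta.
Proof. by rewrite lerDl divr_ge0// ?sqrtr_ge0// ltW// pickup_const_gt0. Qed.

Lemma trip_pickup_time_gt0 : 0 < theta.
Proof. exact: lt_le_trans (trip_time_gt0 P) trip_pickup_time_ge. Qed.

Lemma customers_bounds (t : R) : 0 <= t -> 0 <= q t <= n%:R.
Proof.
move=> t0; have [? ? ? ? ?] := fleet_ge0 sys t0; have := fleet_sum sys t0.
by rewrite /customers => ->; apply/andP; split; lra.
Qed.

Lemma departure_rate_le (t : R) : 0 <= t ->
  ((q t)%:E / ((trip_time P)%:E + pickup_time x t) <= (q t / theta)%:E)%E.
Proof.
move=> t0; have /andP[q0 qn] := customers_bounds _ t0.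
apply: lee_div_fin => //; first exact: trip_pickup_time_gt0.
rewrite EFinD leeD2l//; apply: le_trans (pickup_time_ge sys t0).
by apply: le_div_sqrt; rewrite ?pickup_const_gt0 ?ltr0n//; apply/andP; split; lra.
Qed.

Lemma charger_arrival_rate_le (t : R) : 0 <= t ->
  ((reach_frac x t)%:E * ((cDC x t)%:E / to_charger_time x t) <=
   (cDC x t * Num.sqrt (m%:R - cC x t) / charger_const P)%:E)%E.
Proof.
move=> t0; have /andP[p0 p1] := reach_frac_bounds sys t0.
have [_ _ d0 _ _] := fleet_ge0 sys t0; have tau0 := charger_const_gt0 P.
have := to_charger_time_ge sys t0.
(* With no free charger the travel time is infinite and both sides vanish. *)
have [->|e0] := eqVneq (Num.sqrt (m%:R - cC x t)) 0.
  rewrite inver eqxx gt0_muley ?lte_fin// leye_eq => /eqP ->.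
  by rewrite invey mule0 mule0 mulr0 mul0r.
have epos : 0 < Num.sqrt (m%:R - cC x t) by rewrite lt_neqAle eq_sym e0 sqrtr_ge0.
rewrite inver (negbTE e0) -EFinM => T_ge.
have b0 : 0 < charger_const P / Num.sqrt (m%:R - cC x t) by rewrite divr_gt0.
apply: (@le_trans _ _ ((cDC x t)%:E / to_charger_time x t)%E).
  by rewrite gee_pMl// ?lee_fin//; exact: (div_ge0_fin _ _ _ _ d0 b0 T_ge).
apply: le_trans (lee_div_fin _ _ _ _ d0 b0 T_ge) _.
by rewrite lee_fin invf_div mulrA.
Qed.

(** The equations of motion freed of extended reals: an infinite travel time
    only makes a flow vanish.  The vehicles that discharge, [n - cC - cI], are
    those with a customer or on their way to one, and those driving to a
    charger. *)
Lemma dynamics_bounds : {ae lebesgue_measure, forall t : R, 0 < t ->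
  [/\ derivable q t 1, derivable (cC x) t 1 & derivable (soc x) t 1] /\
  [/\ eff_rate x t <= derive1 q t + q t / theta,
      derive1 (cC x) t <= cDC x t * Num.sqrt (m%:R - cC x t) / charger_const P - K * cC x t &
      derive1 (soc x) t = charge_rate P * (cC x t - r * (q t + cDC x t))]}.
Proof.
have [_ dq] := customers_evol sys; have [_ dc] := charging_evol sys.
have [_ ds] := soc_evol sys.
apply: filterS3 dq dc ds; first exact: (ae_filter_ringOfSetsType lebesgue_measure).
move=> t Hq Hc Hs t0.
have [Dq Eq] := Hq t0; have [Dc Ec] := Hc t0; have [Ds [Es]] := Hs t0.
have t0' := ltW t0.
split=> //; split.
- have := departure_rate_le t t0'; move: Eq.
  case: ((q t)%:E / ((trip_time P)%:E + pickup_time x t))%E => [z| |]//= [->].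
  by rewrite lee_fin; lra.
- have := charger_arrival_rate_le t t0'; move: Ec.
  case: ((reach_frac x t)%:E * ((cDC x t)%:E / to_charger_time x t))%E => [z| |]//= [->].
  rewrite lee_fin => zle.
  have /andP[T0 TK] := charging_time_bounds sys t0'.
  have [_ _ _ _ c0] := fleet_ge0 sys t0'.
  rewrite lerB// mulrC ler_wpM2l//.
  by rewrite /unplug_rate -invf_div lef_pV2// posrE// divr_gt0 ?charge_rate_gt0 ?pack_size_gt0.
- rewrite Es; have -> : n%:R - cC x t - cI x t = q t + cDC x t.
    by rewrite (fleet_sum sys t0') /customers; lra.
  by rewrite /rate_ratio; field; rewrite gt_eqF// charge_rate_gt0.
Qed.

End dynamics.

(** * The requirement on vehicles and chargers *)

(** As a function of [s = W ^+ 2] the right-hand side [N / sqrt s - sqrt s] is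
    convex, and the left-hand side is its tangent at [s = w ^+ 2]. *)
Lemma inv_sqrt_tangent (R : realFieldType) (N w W : R) : 0 <= N -> 0 < w -> 0 < W ->
  (3 * N - w ^+ 2) / (2 * w) - (N + w ^+ 2) / (2 * w ^+ 3) * W ^+ 2 <= (N - W ^+ 2) / W.
Proof.
move=> N0 w0 W0.
rewrite -subr_ge0.
have -> : (N - W ^+ 2) / W - ((3 * N - w ^+ 2) / (2 * w) -
      (N + w ^+ 2) / (2 * w ^+ 3) * W ^+ 2) =
    (W - w) ^+ 2 * (N * (W + 2 * w) + w ^+ 2 * W) / (2 * w ^+ 3 * W).
  by field; rewrite !gt_eqF.
have den0 : 0 < 2 * w ^+ 3 * W by rewrite mulr_gt0 ?mulr_gt0 ?exprn_gt0.
have num0 : 0 <= N * (W + 2 * w) + w ^+ 2 * W.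
  by rewrite addr_ge0 ?mulr_ge0 ?sqr_ge0//; lra.
by apply: divr_ge0; [rewrite mulr_ge0 ?sqr_ge0|exact: ltW].
Qed.

(** [k] is a resource that covers [v] times the driving vehicles, up to the
    imbalance of the state of charge: with [v = 1 + r] it is the fleet, and with
    [v = r] the chargers.  By Little's law [trip_pickup_time P n * (alpha * lambda)]
    vehicles serve customers on average; the other summand bounds from below the
    vehicles driving to a charger, for every position [w ^+ 2] of the supporting
    line. *)
Lemma fleet_requirement (R : realType) (P : ev_params R) (lambda alpha : R) (n m : nat)
    (x : ev_traj R) (v k w eta : R) :
  (1 <= n)%N -> 0 < lambda -> ev_system P lambda n m x ->
  (alpha%:E <= service_level lambda x)%E ->
  0 <= v -> 0 < w -> 0 < eta ->
  (forall t, 0 <= t ->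
     v * (customers x t + cDC x t) + (cC x t - rate_ratio P * (customers x t + cDC x t)) <= k) ->
  v * (trip_pickup_time P n * (alpha * lambda)
    + charger_const P * unplug_rate P * ((3 * (m%:R + eta) - w ^+ 2) / (2 * w)
      - (m%:R + eta + w ^+ 2) / (2 * w ^+ 3)
        * (m%:R + eta - rate_ratio P * (trip_pickup_time P n * (alpha * lambda))))) <= k.
Proof.
move=> n0 lambda0 sys sl v0 w0 eta0 vk.
set N := m%:R + eta; set K := unplug_rate P.
set L := trip_pickup_time P n * (alpha * lambda).
set theta := trip_pickup_time P n in L *; set r := rate_ratio P in vk *.
set tau := charger_const P; set q := customers x in vk *.
set a := (3 * N - w ^+ 2) / (2 * w); set b := (N + w ^+ 2) / (2 * w ^+ 3).
have rc0 := charge_rate_gt0 _ P; have r0 : 0 < r := rate_ratio_gt0 _ P.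
have tau0 : 0 < tau := charger_const_gt0 P.
have K0 : 0 < K by rewrite divr_gt0 ?pack_size_gt0.
have theta0 : 0 < theta := trip_pickup_time_gt0 _ _ _.
have N0 : 0 < N by rewrite ltr_wpDl.
have b0 : 0 < b by apply: divr_gt0; [apply: addr_gt0|rewrite mulr_gt0]; rewrite ?exprn_gt0.
pose W t := Num.sqrt (N - cC x t).
(* The weights of the balances of customers, of charge and of free chargers.
   The supporting line is linear in [cC], which the balances of charge and of
   customers turn into [r * theta * alpha * lambda]; hence the factor
   [1 + tau * K * b * r] and the first summand of [c2]. *)
pose c1 := v * theta * (1 + tau * K * b * r).
pose c2 := (v * tau * K * b + 1) / charge_rate P.
pose c3 := 2 * v * tau.
pose G t := (- c1) * q t + c2 * soc x t + (- c3) * W t.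
have tKb0 : 0 < tau * K * b by apply: mulr_gt0 b0; exact: mulr_gt0.
have vtKb0 : 0 <= v * tau * K * b by rewrite -(mulrA v tau K) -(mulrA v _ b) mulr_ge0// ltW.
have c10 : 0 <= c1.
  apply: mulr_ge0; first by rewrite mulr_ge0// ltW.
  by apply: addr_ge0 => //; rewrite mulr_ge0// ltW.
have c20 : 0 <= c2 by rewrite divr_ge0 ?addr_ge0// ltW.
have c30 : 0 <= c3 by apply: mulr_ge0; rewrite ?mulr_ge0// ltW.
have cb t : 0 <= t -> 0 <= cC x t <= m%:R.
  by move=> t0; rewrite (chargers_le sys t0) andbT; have [] := fleet_ge0 sys t0.
suff : c1 * (alpha * lambda) <= k - v * tau * K * (a - b * N).
  rewrite /c1 -subr_ge0 => H; rewrite -subr_ge0; apply: le_trans H _.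
  by rewrite le_eqVlt; apply/orP; left; apply/eqP; rewrite /L; ring.
apply: (@service_level_le _ lambda alpha c1 _
  (c1 * n%:R + c2 * (n%:R * pack_size P) + c3 * Num.sqrt N) x G) => //.
- exact: eff_rate_measurable sys.
- exact: eff_rate_bounds sys.
- move=> T T0; apply: abs_continuousD; first apply: abs_continuousD.
  + by apply: abs_continuousZ; exact: (customers_evol sys).1.
  + by apply: abs_continuousZ; exact: (soc_evol sys).1.
  + apply: abs_continuousZ.
    have acc := (charging_evol sys).1 T T0.
    (* The square root is Lipschitz on [[eta, +oo[[. *)
    apply: (abs_continuous_dominated _ _ _ (Num.sqrt eta)^-1 _ _ _ acc acc) => u t u0 ut _.
    have /andP[cu0 cum] := cb _ u0; have /andP[ct0 ctm] := cb _ (le_trans u0 ut).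
    have Wu : Num.sqrt eta <= W u by apply: ler_wsqrtr; rewrite /N; lra.
    have Wt : Num.sqrt eta <= W t by apply: ler_wsqrtr; rewrite /N; lra.
    have e0 : 0 < Num.sqrt eta by rewrite sqrtr_gt0.
    have WW : (W t - W u) * (W t + W u) = cC x u - cC x t.
      by rewrite -subr_sqr !sqr_sqrtr /N; lra.
    rewrite mulrC ler_pdivlMr// (le_trans _ (_ : `|cC x t - cC x u| <= _)) ?lerDl//.
    rewrite [leRHS]distrC -WW normrM ler_wpM2l// ger0_norm; lra.
- move=> T T0.
  have /andP[q0 qn] := customers_bounds _ _ _ _ _ _ sys _ T0.
  have /andP[s0 sn] := soc_bounds sys T0; have /andP[cc0 cm] := cb _ T0.
  have W0 : 0 <= W T := sqrtr_ge0 _.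
  have WN : W T <= Num.sqrt N by apply: ler_wsqrtr; lra.
  have A1 : 0 <= c1 * q T by rewrite mulr_ge0.
  have A2 : c1 * q T <= c1 * n%:R by rewrite ler_wpM2l.
  have A3 : 0 <= c2 * soc x T by rewrite mulr_ge0.
  have A4 : c2 * soc x T <= c2 * (n%:R * pack_size P) by rewrite ler_wpM2l.
  have A5 : 0 <= c3 * W T by rewrite mulr_ge0.
  have A6 : c3 * W T <= c3 * Num.sqrt N by rewrite ler_wpM2l.
  by rewrite /G ler_norml; apply/andP; split; lra.
have := dynamics_bounds _ _ _ _ _ _ n0 sys.
apply: filterS; first exact: (ae_filter_ringOfSetsType lebesgue_measure).
move=> t H t0; have [[dq dc ds] [Eq Ec Es]] := H t0; have t0' := ltW t0.
have /andP[cc0 cm] := cb _ t0'.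
have [_ _ d0 _ _] := fleet_ge0 sys t0'.
have WW : W t ^+ 2 = N - cC x t by rewrite sqr_sqrtr// /N; lra.
have W0 : 0 < W t by rewrite sqrtr_gt0 /N; lra.
have dW : is_derive t 1 W (- derive1 (cC x) t / (2 * W t)).
  have dc' : is_derive t 1 (cC x) (derive1 (cC x) t) by split; rewrite // derive1E.
  have W0' : 0 < N - cC x t by rewrite /N; lra.
  have dN : is_derive t 1 (fun u => N - cC x u) (0 - derive1 (cC x) t).
    by apply: is_deriveB.
  have := @is_derive1_comp _ Num.sqrt (fun u => N - cC x u) t _ _ (is_derive1_sqrt W0') dN.
  by rewrite sub0r mulrC.
move: Eq Ec Es; rewrite !derive1E => Eq Ec Es.
have dG : is_derive t 1 G ((- c1) * 'D_1 q t + c2 * 'D_1 (soc x) t +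
    (- c3) * (- derive1 (cC x) t / (2 * W t))).
  have dq' : is_derive t 1 q ('D_1 q t) by split.
  have ds' : is_derive t 1 (soc x) ('D_1 (soc x) t) by split.
  by rewrite /G; apply: is_deriveD.
split; first exact: ex_derive.
rewrite derive_val derive1E Es.
set c' := 'D_1 (cC x) t in Ec *.
set d := cDC x t in d0 Ec *.
have B1 : c1 * (eff_rate x t - 'D_1 q t) <= v * (1 + tau * K * b * r) * q t.
  have -> : v * (1 + tau * K * b * r) * q t = c1 * (q t / theta).
    by rewrite /c1; field; rewrite gt_eqF.
  by rewrite ler_wpM2l// lerBlDl.
have B2 : c2 * (charge_rate P * (cC x t - r * (q t + d))) =
    (v * tau * K * b + 1) * (cC x t - r * (q t + d)).
  by rewrite /c2; field; rewrite gt_eqF.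
(* The balance of free chargers: [cDC] is bounded below without the factor
   [sqrt (m - cC)], which [W] absorbs. *)
have B3 : (- c3) * (- c' / (2 * W t)) <= v * d - v * tau * K * (a - b * W t ^+ 2).
  have -> : (- c3) * (- c' / (2 * W t)) = v * (tau * c' / W t).
    by rewrite /c3; field; rewrite gt_eqF.
  have -> : v * d - v * tau * K * (a - b * W t ^+ 2) =
            v * (d - tau * K * (a - b * W t ^+ 2)) by ring.
  rewrite ler_wpM2l//.
  have tang := inv_sqrt_tangent _ _ _ _ (ltW N0) w0 W0.
  have : tau * K * (a - b * W t ^+ 2) <= tau * K * ((N - W t ^+ 2) / W t).
    by rewrite ler_wpM2l// ltW// mulr_gt0.
  suff : tau * c' / W t <= d - tau * K * ((N - W t ^+ 2) / W t) by lra.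
  rewrite ler_pdivrMr//.
  have -> : (d - tau * K * ((N - W t ^+ 2) / W t)) * W t = d * W t - tau * K * cC x t.
    by rewrite WW; field; rewrite gt_eqF.
  have sW : Num.sqrt (m%:R - cC x t) <= W t by apply: ler_wsqrtr; rewrite /N; lra.
  have : d * Num.sqrt (m%:R - cC x t) <= d * W t by rewrite ler_wpM2l.
  have : tau * c' <= tau * (d * Num.sqrt (m%:R - cC x t) / tau - K * cC x t).
    by rewrite ler_wpM2l// ltW.
  rewrite mulrBr [tau * (_ / tau)]mulrC divfK ?gt_eqF//; lra.
have := vk t t0'; rewrite -/d.
have B4 : 0 <= v * tau * K * b * r * d.
  by apply: mulr_ge0 => //; apply: mulr_ge0 => //; exact: ltW.
rewrite WW in B3; rewrite B2.
lra.
Qed.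

(** * The trade-off and the exponent *)

(** The supporting line of [fleet_requirement] is placed at
    [w ^+ 2 = m - r * L + eta]: the chargers beyond the [r * L] that are busy on
    average bound the average number of free ones, and this choice makes the
    bound on drives to chargers take its steady-state value [C * L / w]. *)
Lemma capacity_tradeoff (R : realType) (P : ev_params R) (lambda alpha : R) (n m : nat)
    (x : ev_traj R) :
  (1 <= n)%N -> 0 < lambda -> 0 <= alpha -> ev_system P lambda n m x ->
  (alpha%:E <= service_level lambda x)%E ->
  let r := rate_ratio P in
  let L := trip_pickup_time P n * (alpha * lambda) in
  let C := charger_const P * unplug_rate P * r in
  r * L <= m%:R /\ forall eta, 0 < eta ->
    let w := Num.sqrt (m%:R - r * L + eta) in
    (1 + r) * (L + C * L / w) <= n%:R /\ r * (L + C * L / w) <= m%:R.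
Proof.
move=> n0 lambda0 alpha0 sys sl r L C.
have r0 : 0 < r := rate_ratio_gt0 _ P.
have tau0 := charger_const_gt0 P.
have K0 : 0 < unplug_rate P by rewrite divr_gt0 ?pack_size_gt0// charge_rate_gt0.
have L0 : 0 <= L.
  by apply: mulr_ge0; [exact/ltW/trip_pickup_time_gt0|apply: mulr_ge0 => //; exact: ltW].
have C0 : 0 < C by apply: mulr_gt0 => //; exact: mulr_gt0.
have chargers t : 0 <= t ->
    r * (customers x t + cDC x t) + (cC x t - r * (customers x t + cDC x t)) <= m%:R.
  by move=> t0; have := chargers_le sys t0; lra.
have vehicles t : 0 <= t ->
    (1 + r) * (customers x t + cDC x t) + (cC x t - r * (customers x t + cDC x t)) <= n%:R.
  move=> t0; rewrite (fleet_sum sys t0); have [_ _ _ ? _] := fleet_ge0 sys t0.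
  by rewrite /customers; lra.
(* If [m < r * L], the line at [w = 1] already gives a nonnegative bound on the
   drives to chargers, and [m] would cover [r * L]. *)
have Y0 : r * L <= m%:R.
  rewrite leNgt; apply/negP => mL.
  have := @fleet_requirement _ _ _ _ _ _ _ _ _ 1 1 n0 lambda0 sys sl (ltW r0) ltr01 ltr01 chargers.
  rewrite -/r -/L => H.
  have : 0 <= charger_const P * unplug_rate P * ((3 * (m%:R + 1) - 1 ^+ 2) / (2 * 1)
      - (m%:R + 1 + 1 ^+ 2) / (2 * 1 ^+ 3) * (m%:R + 1 - r * L)).
    apply: mulr_ge0; first exact/ltW/mulr_gt0.
    have m0 : 0 <= m%:R :> R by [].
    rewrite !expr1n !mulr1.
    have : (m%:R + 1 + 1) / 2 * (m%:R + 1 - r * L) <= (m%:R + 1 + 1) / 2.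
      by rewrite ler_piMr; lra.
    lra.
  set z := (X in 0 <= X) in H * => z0.
  have rLz : r * L <= r * (L + z) by rewrite ler_wpM2l// ?(ltW r0)// lerDl.
  by have := le_lt_trans (le_trans rLz H) mL; rewrite ltxx.
split=> // eta eta0 w.
have w0 : 0 < w by rewrite sqrtr_gt0; lra.
have ww : w ^+ 2 = m%:R - r * L + eta by rewrite sqr_sqrtr//; lra.
have E : charger_const P * unplug_rate P * ((3 * (m%:R + eta) - w ^+ 2) / (2 * w)
      - (m%:R + eta + w ^+ 2) / (2 * w ^+ 3) * (m%:R + eta - r * L)) = C * L / w.
  have -> : m%:R + eta - r * L = w ^+ 2 by rewrite ww; ring.
  have -> : C * L / w = charger_const P * unplug_rate P * ((m%:R + eta - w ^+ 2) / w).
    by rewrite ww /C; field; rewrite gt_eqF.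
  by field; rewrite gt_eqF.
split.
- have r1 : 0 <= 1 + r by lra.
  have := @fleet_requirement _ _ _ _ _ _ _ _ _ w eta n0 lambda0 sys sl r1 w0 eta0 vehicles.
  by rewrite E.
- have := @fleet_requirement _ _ _ _ _ _ _ _ _ w eta n0 lambda0 sys sl (ltW r0) w0 eta0 chargers.
  by rewrite E.
Qed.

(** Lets [eta] go to 0; it only serves to keep the square root differentiable
    when no charger is free. *)
Lemma sqr_le_of_div_sqrt (R : realType) (z X Y : R) : 0 <= z -> 0 <= Y ->
  (forall eta, 0 < eta -> z / Num.sqrt (Y + eta) <= X) -> z ^+ 2 <= X ^+ 2 * Y.
Proof.
move=> z0 Y0 H.
have X0 : 0 <= X by apply: le_trans (H 1 ltr01); rewrite divr_ge0// sqrtr_ge0.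
apply/ler_addgt0Pr => e e0.
have eta0 : 0 < e / (X ^+ 2 + 1) by rewrite divr_gt0// ltr_wpDl// sqr_ge0.
have := H _ eta0; set eta := e / _ in eta0 *.
have w0 : 0 < Num.sqrt (Y + eta) by rewrite sqrtr_gt0 ltr_wpDl.
rewrite ler_pdivrMr// => zX.
have : z ^+ 2 <= (X * Num.sqrt (Y + eta)) ^+ 2 by rewrite ler_pXn2r ?nnegrE// mulr_ge0// ltW.
rewrite exprMn sqr_sqrtr; last by rewrite addr_ge0// ltW.
have : X ^+ 2 * eta <= e.
  by rewrite /eta mulrCA ler_piMr ?(ltW e0)// ler_pdivrMr ?mul1r ?lerDl// ltr_wpDl// sqr_ge0.
lra.
Qed.

(** Any [gamma] with [c * lam `^ (2 * gamma) <= Y <= lam `^ (2 * gamma)] works, by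
    the product bound.  For [Y] in [[lam `^ (2 / 3), lam]] this is achieved by
    [lam `^ (2 * gamma) = Y], and for smaller [Y] by [gamma = 1/3]; for larger
    [Y], and for [lam < 1], the square-root bound on [X] serves [gamma = 1/2]. *)
Lemma exponent_choice (R : realType) (lam X Y c : R) :
  0 < lam -> 0 < c -> c <= 1 -> 0 <= X -> 0 <= Y ->
  c * Num.sqrt lam <= X -> (c * lam) ^+ 2 <= X ^+ 2 * Y -> c ^+ 3 * lam ^+ 2 <= Y ^+ 3 ->
  exists gamma : R, [/\ 3^-1 <= gamma <= 2^-1,
     c * lam `^ (1 - gamma) <= X & c * lam `^ (2 * gamma) <= Y].
Proof.
move=> lam0 c0 c1 X0 Y0 XS XY YY.
have lamn0 : lam != 0 by rewrite gt_eqF.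
have YY' : c * lam `^ (2 / 3) <= Y.
  rewrite -(ler_pXn2r (_ : 0 < 3)%N) ?nnegrE ?mulr_ge0 ?(ltW c0) ?powR_ge0//.
  rewrite exprMn -[_ `^ _ ^+ 3]powR_mulrn ?powR_ge0// -powRrM.
  have -> : 2 / 3 * 3%:R = 2%:R :> R by field.
  by rewrite powR_mulrn// ltW.
have half : c * lam `^ (1 - 2^-1) <= X.
  have -> : 1 - 2^-1 = 2^-1 :> R by field.
  by rewrite powR12_sqrt// ltW.
have two_half : 2 * 2^-1 = 1 :> R by field.
have sufY g : Y <= lam `^ (2 * g) -> c * lam `^ (1 - g) <= X.
  move=> Yg; rewrite -(ler_pXn2r (_ : 0 < 2)%N) ?nnegrE ?mulr_ge0 ?(ltW c0) ?powR_ge0//.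
  rewrite -(ler_pM2r (powR_gt0 (2 * g) lam0)).
  apply: le_trans (_ : X ^+ 2 * Y <= _); last by rewrite ler_wpM2l ?sqr_ge0.
  apply: le_trans XY; rewrite !exprMn -mulrA ler_wpM2l ?sqr_ge0//.
  rewrite -[_ `^ _ ^+ 2]powR_mulrn ?powR_ge0// -powRrM -powRD ?lamn0 ?implybT//.
  have -> : (1 - g) * 2%:R + 2 * g = 2%:R by ring.
  by rewrite powR_mulrn// ltW.
have [lam1|lam1] := ltP lam 1.
  exists 2^-1; split => //; first by apply/andP; split; lra.
  rewrite two_half powRr1 ?(ltW lam0)//; apply: le_trans YY'.
  rewrite ler_wpM2l ?(ltW c0)//; apply: ger1_powR; last by lra.
  by rewrite lam0 ltW.
have [Yl|Yl] := leP lam Y.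
  exists 2^-1; split => //; first by apply/andP; split; lra.
  rewrite two_half powRr1 ?(ltW lam0)//; apply: le_trans Yl.
  by rewrite ler_piMl// ltW.
have [Y23|Y23] := leP Y (lam `^ (2 / 3)).
  exists 3^-1; split => //; first by apply/andP; split; lra.
  exact: sufY.
have lam1' : 1 < lam.
  rewrite lt_neqAle lam1 andbT; apply/eqP => l1; move: Y23 Yl.
  by rewrite -l1 powR1 => /lt_trans /[apply]; rewrite ltxx.
have Ypos : 0 < Y by apply: lt_trans Y23; exact: powR_gt0.
have ln0 : 0 < ln lam by rewrite ln_gt0.
have E : lam `^ (2 * (ln Y / (2 * ln lam))) = Y.
  have -> : 2 * (ln Y / (2 * ln lam)) = ln Y / ln lam by field; rewrite gt_eqF.
  by rewrite /powR (negbTE lamn0) divfK ?gt_eqF// lnK// posrE.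
exists (ln Y / (2 * ln lam)); split.
- apply/andP; split.
  + rewrite ler_pdivlMr ?mulr_gt0//.
    have -> : 3^-1 * (2 * ln lam) = ln (lam `^ (2 / 3)) by rewrite ln_powR; field.
    by rewrite ler_ln ?posrE ?powR_gt0// ltW.
  + rewrite ler_pdivrMr ?mulr_gt0// mulKf// ler_ln ?posrE// ltW//.
- by apply: sufY; rewrite E.
- by rewrite E ler_piMl// ltW.
Qed.

Theorem theorem1 (R : realType) (P : ev_params R) (delta : R) (hdelta : 0 < delta) :
  exists kappa1 kappa2 : R, [/\ 0 < kappa1, 0 < kappa2 &
    forall alpha : R, delta <= alpha <= 1 ->
    forall (lambda : R) (n m : nat) (x : ev_traj R),
      0 < lambda -> (1 <= n)%N -> (1 <= m)%N ->
      ev_system P lambda n m x ->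
      (alpha%:E <= service_level lambda x <= 1)%E ->
      exists gamma : R, [/\ 3^-1 <= gamma <= 2^-1,
        (1 + rate_ratio P) * trip_time P * alpha * lambda
          + kappa1 * lambda `^ (1 - gamma) <= n%:R &
        rate_ratio P * trip_time P * alpha * lambda
          + kappa2 * lambda `^ (2 * gamma) <= m%:R]].
Proof.
have r0 : 0 < rate_ratio P := rate_ratio_gt0 _ P.
have T0 := trip_time_gt0 P; have tau10 := pickup_const_gt0 P.
have tau20 := charger_const_gt0 P.
have K0 : 0 < unplug_rate P by rewrite divr_gt0 ?pack_size_gt0// charge_rate_gt0.
set r := rate_ratio P in r0 *; set TR := trip_time P in T0 *.
pose C := charger_const P * unplug_rate P * r.
have C0 : 0 < C by apply: mulr_gt0 => //; exact: mulr_gt0.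
(* Beyond [B * lambda] vehicles, half of the fleet is already in excess. *)
pose B := 2 * (1 + r) * TR.
have B0 : 0 < B by apply: mulr_gt0 => //; lra.
have sB0 : 0 < Num.sqrt B by rewrite sqrtr_gt0.
pose c1 := pickup_const P * delta / Num.sqrt B.
pose c2 := C * (TR * delta).
have Td0 : 0 < TR * delta by exact: mulr_gt0.
have c10 : 0 < c1 by rewrite divr_gt0 ?mulr_gt0.
have c20 : 0 < c2 by exact: mulr_gt0.
have rc20 : 0 < r * c2 by exact: mulr_gt0.
pose c := Num.min (Num.min 1 (Num.sqrt B / 2)) (Num.min c1 (Num.min c2 (r * c2))).
have c0 : 0 < c by rewrite !lt_min ltr01 c10 c20 rc20 divr_gt0.
have [cle1 cB cc1 cc2 crc2] : [/\ c <= 1, c <= Num.sqrt B / 2, c <= c1, c <= c2 & c <= r * c2].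
  by split; rewrite /c !ge_min lexx ?orbT.
exists c, c; split => // alpha /andP[da alpha1] lambda n m x lambda0 n0 _ sys /andP[sl _].
have alpha0 : 0 <= alpha by apply: le_trans da; exact: ltW.
have [] := capacity_tradeoff _ _ _ _ _ _ _ n0 lambda0 alpha0 sys sl.
rewrite -/r -/C; set L := trip_pickup_time P n * (alpha * lambda) => YL H.
have TL : TR * alpha * lambda <= L.
  by rewrite -mulrA ler_wpM2r ?trip_pickup_time_ge// mulr_ge0// ltW.
have dL : TR * delta * lambda <= L.
  by apply: le_trans TL; rewrite ler_wpM2r ?(ltW lambda0)// ler_wpM2l// ltW.
have L0 : 0 <= L by apply: le_trans dL; rewrite mulr_ge0// ltW.
pose X := n%:R - (1 + r) * TR * alpha * lambda.
pose Y := m%:R - r * TR * alpha * lambda.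
have CL0 : 0 <= C * L by rewrite mulr_ge0// ltW.
have rCL0 : 0 <= r * (C * L) by rewrite mulr_ge0// ltW.
have YL0 : 0 <= m%:R - r * L by rewrite subr_ge0.
have YLY : m%:R - r * L <= Y.
  have : r * (TR * alpha * lambda) <= r * L by rewrite ler_wpM2l// ltW.
  by rewrite /Y; lra.
have Y0 : 0 <= Y by exact: le_trans YLY.
have XL : n%:R - (1 + r) * L <= X.
  have : (1 + r) * (TR * alpha * lambda) <= (1 + r) * L by rewrite ler_wpM2l//; lra.
  by rewrite /X; lra.
have XLD eta : 0 < eta -> C * L / Num.sqrt (m%:R - r * L + eta) <= n%:R - (1 + r) * L.
  move=> /H [+ _]; set z := C * L / _.
  have z0 : 0 <= z by rewrite divr_ge0// sqrtr_ge0.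
  have : 0 <= r * z by rewrite mulr_ge0// ltW.
  lra.
have YLD eta : 0 < eta -> r * (C * L) / Num.sqrt (m%:R - r * L + eta) <= m%:R - r * L.
  by move=> /H [_ +]; rewrite -mulrA; lra.
have XL0 : 0 <= n%:R - (1 + r) * L.
  by apply: le_trans (XLD 1 ltr01); rewrite divr_ge0// sqrtr_ge0.
have X0 : 0 <= X by exact: le_trans XL.
have c2L : c2 * lambda <= C * L by rewrite /c2 -mulrA ler_wpM2l// ltW.
have XY : (c * lambda) ^+ 2 <= X ^+ 2 * Y.
  apply: (@le_trans _ _ ((C * L) ^+ 2)).
    rewrite ler_pXn2r ?nnegrE ?CL0 ?(mulr_ge0 (ltW c0) (ltW lambda0))//.
    by apply: le_trans c2L; rewrite ler_wpM2r// ltW.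
  have sq := sqr_le_of_div_sqrt _ _ _ _ CL0 YL0 XLD.
  apply: (le_trans sq).
  by rewrite ler_pM ?sqr_ge0// ler_pXn2r.
have YY : c ^+ 3 * lambda ^+ 2 <= Y ^+ 3.
  apply: (@le_trans _ _ ((r * (C * L)) ^+ 2)).
    apply: (@le_trans _ _ ((r * c2 * lambda) ^+ 2)).
      rewrite exprMn ler_wpM2r ?sqr_ge0//.
      apply: (@le_trans _ _ (c ^+ 2)).
        by rewrite exprS ler_piMl ?sqr_ge0.
      by rewrite ler_pXn2r ?nnegrE ?(ltW c0) ?(ltW rc20).
    rewrite ler_pXn2r ?nnegrE ?rCL0 ?(mulr_ge0 (ltW rc20) (ltW lambda0))//.
    by rewrite -mulrA ler_wpM2l// ltW.
  have sq := sqr_le_of_div_sqrt _ _ _ _ rCL0 YL0 YLD.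
  apply: (le_trans sq).
  by rewrite -exprSr ler_pXn2r.
have XS : c * Num.sqrt lambda <= X.
  have sn0 : 0 < Num.sqrt n%:R :> R by rewrite sqrtr_gt0 ltr0n.
  have nn : Num.sqrt n%:R ^+ 2 = n%:R :> R by rewrite sqr_sqrtr.
  have sl0 := sqrtr_ge0 lambda.
  have sll : Num.sqrt lambda ^+ 2 = lambda by rewrite sqr_sqrtr// ltW.
  (* The pickup times matter when [n] is of order [lambda]. *)
  have [nB|nB] := leP n%:R (B * lambda).
    have sqn : Num.sqrt n%:R <= Num.sqrt B * Num.sqrt lambda.
      by rewrite -sqrtrM ?(ltW B0)// ler_wsqrtr.
    have Lt : pickup_const P / Num.sqrt n%:R * (alpha * lambda) = L - TR * alpha * lambda.
      by rewrite /L /trip_pickup_time -/TR; ring.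
    apply: (@le_trans _ _ (L - TR * alpha * lambda)).
      rewrite -Lt mulrAC ler_pdivlMr//.
      apply: (@le_trans _ _ (c1 * Num.sqrt lambda * (Num.sqrt B * Num.sqrt lambda))).
        by rewrite ler_pM ?mulr_ge0 ?(ltW c0) ?(ltW sn0)// ler_wpM2r.
      have -> : c1 * Num.sqrt lambda * (Num.sqrt B * Num.sqrt lambda) =
          pickup_const P * (delta * lambda).
        by rewrite -[in RHS]sll /c1; field; rewrite gt_eqF.
      by rewrite ler_wpM2l ?(ltW tau10)// ler_wpM2r// ltW.
    have : 0 <= r * (L - TR * alpha * lambda) by rewrite mulr_ge0 ?(ltW r0)// subr_ge0.
    by rewrite /X; lra.
  have nX : n%:R / 2 <= X.
    have : (1 + r) * TR * (alpha * lambda) <= (1 + r) * TR * lambda.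
      rewrite ler_wpM2l//; first by rewrite mulr_ge0 ?(ltW T0)//; lra.
      by rewrite ler_piMl// ltW.
    by move: nB; rewrite /X /B; lra.
  apply: le_trans nX.
  have n1 : 1 <= Num.sqrt n%:R :> R by rewrite -[leLHS]sqrtr1; apply: ler_wsqrtr; rewrite ler1n.
  have sqn : Num.sqrt B * Num.sqrt lambda <= Num.sqrt n%:R.
    by rewrite -sqrtrM ?(ltW B0)// ler_wsqrtr// ltW.
  have : c * Num.sqrt lambda <= Num.sqrt B / 2 * Num.sqrt lambda by rewrite ler_wpM2r.
  have : Num.sqrt n%:R <= n%:R :> R by rewrite -[leRHS]nn expr2 ler_peMr// ltW.
  lra.
have [gamma [g XG YG]] := exponent_choice _ _ _ _ _ lambda0 c0 cle1 X0 Y0 XS XY YY.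
exists gamma; split => //; move: XG YG; rewrite /X /Y; lra.
Qed.
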